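(* Let $n\ge 2w\ge 2$ and $e\ge 1$ be integers and put $\bar\omega=n-w$. If there exists a nontrivial $e$-perfect code in $J(n,w)$ with strength $\varphi$ and strength redundancy $d=w-\varphi$, then $\Phi_e(n,w)$ divides the product of all primes $p$ for which there is an integer $s\ge 1$ with $$\bar\omega<p^{s}\le\bar\omega+d.$$ In particular, $\Phi_e(n,w)$ is square-free.
   Context: The Johnson scheme $J(n,w)$ has as elements all $w$-subsets of $[n]=\{1,\dots,n\}$, with distance $d(X,Y)=|X\setminus Y|$. The $e$-ball centred at $X$ is the set of $w$-subsets at distance at most $e$ from $X$; its size is $\Phi_e(n,w)=\sum_{i=0}^{e}\binom{w}{i}\binom{n-w}{i}$. An $e$-perfect code in $J(n,w)$ is a set $\mathcal C$ of $w$-subsets such that the $e$-balls centred at the elements of $\mathcal C$ partition the set of all $w$-subsets of $[n]$. It is trivial if $e=0$, or $|\mathcal C|=1$, or $n=2w$, $w=2e+1$ and $\mathcal C$ consists of a $w$-subset and its complement; otherwise it is nontrivial. A set $\mathcal C$ of $w$-subsets of $[n]$ is a $t$-design if there is $\lambda$ such that every $t$-subset of $[n]$ is contained in exactly $\lambda$ elements of $\mathcal C$. The strength $\varphi$ of $\mathcal C$ is the largest $t\le w$ for which $\mathcal C$ is a $t$-design, and $d=w-\varphi$ is its strength redundancy. *)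

(* Defs.v *)
From mathcomp Require Import all_boot.

Set Implicit Arguments.
Unset Strict Implicit.
Unset Printing Implicit Defensive.

(* The point set [n] = {1, ..., n} is represented by 'I_n = {0, ..., n - 1}. *)

Definition johnson (n w : nat) : {set {set 'I_n}} :=
  [set X : {set 'I_n} | #|X| == w].

Definition johnson_dist (n : nat) (X Y : {set 'I_n}) : nat := #|X :\: Y|.

Definition johnson_ball (n w e : nat) (X : {set 'I_n}) : {set {set 'I_n}} :=
  [set Y in johnson n w | johnson_dist X Y <= e].

Definition Phi (e n w : nat) : nat :=
  \sum_(0 <= i < e.+1) 'C(w, i) * 'C(n - w, i).

(* The balls form a partition as a family indexed by the codewords; since the
   image set forgets multiplicities, the injectivity clause is what excludes
   distinct codewords having the same ball. *)
Definition perfect_code (n w e : nat) (C : {set {set 'I_n}}) : Prop :=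
  [/\ C \subset johnson n w,
      {in C &, injective (johnson_ball w e)}
    & partition [set johnson_ball w e X | X in C] (johnson n w)].

Definition trivial_code (n w e : nat) (C : {set {set 'I_n}}) : Prop :=
  [\/ e = 0,
      #|C| = 1
    | [/\ n = 2 * w, w = 2 * e + 1
        & exists2 X : {set 'I_n}, X \in johnson n w & C = [set X; ~: X]]].

Definition nontrivial_perfect_code (n w e : nat) (C : {set {set 'I_n}}) : Prop :=
  perfect_code w e C /\ ~ trivial_code w e C.

Definition is_design (n t : nat) (C : {set {set 'I_n}}) : Prop :=
  exists lambda : nat, forall T : {set 'I_n},
    #|T| = t -> #|[set X in C | T \subset X]| = lambda.

Definition has_strength (n w : nat) (C : {set {set 'I_n}}) (phi : nat) : Prop :=
  [/\ phi <= w, is_design phi C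
    & forall t, t <= w -> is_design t C -> t <= phi].

(* Bounding s by b loses nothing: see has_power_inP. *)
Definition has_power_in (a b p : nat) : bool :=
  [exists s : 'I_b.+1, (1 <= s) && (a < p ^ s <= b)].

Lemma has_power_inP (a b p : nat) : prime p ->
  reflect (exists2 s, 1 <= s & a < p ^ s <= b) (has_power_in a b p).
Proof.
move=> p_pr; apply: (iffP existsP) => [[s /andP[s1 ps]]|[s s1 ps]].
  by exists s.
have sb : s < b.+1.
  case/andP: ps => _; apply: leq_trans.
  exact: ltnW (ltn_expl s (prime_gt1 p_pr)).
by exists (Ordinal sb); rewrite /= s1.
Qed.

(* A prime p with a < p ^ s <= b and 1 <= s satisfies p <= b, so the product
   ranges over all such primes. *)
Definition prod_primes_power_in (a b : nat) : nat :=
  \prod_(0 <= p < b.+1 | prime p && has_power_in a b p) p.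

Definition squarefree (m : nat) : Prop :=
  forall k : nat, k ^ 2 %| m -> k = 1.

(* Main.v *)
Require Import Defs.
From Stdlib Require Import ZArith.
From mathcomp Require Import all_boot all_order all_algebra fingroup perm.
From mathcomp Require Import zify ring.
Import Order.TTheory GRing.Theory Num.Theory.

Set Implicit Arguments.
Unset Strict Implicit.
Unset Printing Implicit Defensive.

(** Write [w'] for [n - w] and [N] for [n - phi = w' + d].

    Counting.  A design of strength [phi] has a constant number of blocks
    meeting a fixed [phi]-set in a fixed [(w - k)]-subset, and for a perfect
    code this number is ['C(N, k) / Phi].  Hence [Phi] divides ['C(N, k)] for
    all [d <= k <= w], and also for all [N - w <= k <= w'] by symmetry
    ([design_dvd_bin]).  If [p ^ j] divides [k], the exponent of [p] in
    ['C(N, k)] is at most [trunc_log p N - j] ([logn_bin_le]).  Suppose that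
    every positive [q <= w'] has a multiple [k] in these two ranges.  Let
    [p ^ s] be the largest power of [p] up to [N].  If [p ^ s <= w'], then
    [q = p ^ s] shows that [p] does not divide [Phi]; otherwise
    [q = p ^ (s - 1) <= N / 2 <= w'] shows that [p ^ 2] does not divide [Phi].
    This is the theorem ([dvdn_prod_primes_power_in]).

    The multiples exist as soon as [2 * d <= w + 2] and [N <= 2 * w + 1]
    ([multiple_in_range]): the first range is long enough to contain a multiple
    of any [q < d], and no [q] falls between the ranges.  So what remains is to
    show that the strength [phi = w - d] is large.

    Strength.  For disjoint pairs [(a_j, b_j)], [j <= t], the product of the
    differences [[a_j in X] - [b_j in X]] is an eigenfunction of the Johnson
    graph ([pair_fun_eigen]), so its sum over a ball of radius [i] is its value
    at the centre times a number [mu_i] subject to a three-term recurrence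
    ([ball_recurrence]).  Its sum over all [w]-sets is zero, and the balls
    around the codewords partition them; so if [mu_e] is nonzero, its sum over
    the code vanishes.  If this holds for all families of at most [t] pairs,
    the code is a [t]-design ([pair_sums_design]).  The recurrence gives
    [mu_e > 0] for [t <= (w - 1) / 2] ([lloyd_recurrence_pos])
    provided that [e ^ 2 + 4 * e + 2 <= w] and [w' <= 2 * w]; for [e = 1] it
    gives [mu_1 > 0] for [t < n - 2 * w] as well.

    Local structure.  The required relations between [e], [w] and [w'] follow
    from the codewords [Y] at the minimum distance [2 * e + 1] from a codeword
    [X]: each pair of [(e + 1)]-sets inside and outside [X] is contained in
    [(X :\: Y, Y :\: X)] for exactly one such [Y].  Counting as in Fisher's
    inequality for Steiner systems yields the quadratic lower bound on [w]
    ([fisher_bound]), and a packing argument yields an upper bound on [w']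
    ([roos_bound]), which also rules out [w = 2 * e + 1]. *)

(** * Local structure of a perfect code *)

Lemma exists_subset_card (T : finType) (S : {set T}) k :
  k <= #|S| -> exists2 A : {set T}, A \subset S & #|A| = k.
Proof.
move=> kS; exists [set x in take k (enum S)].
  by apply/subsetP => x; rewrite inE => /mem_take; rewrite mem_enum.
rewrite cardsE; have /card_uniqP -> : uniq (take k (enum S)).
  exact: take_uniq (enum_uniq S).
by rewrite size_take -cardE; case: ltngtP kS.
Qed.

Lemma sum_card_disjoint (I T : finType) (P : {set I}) (F : I -> {set T})
    (S : {set T}) :
  (forall i, i \in P -> F i \subset S) ->
  (forall i j u, i \in P -> j \in P -> u \in F i -> u \in F j -> i = j) ->
  \sum_(i in P) #|F i| <= #|S|.
Proof.
move=> FS Fdis; rewrite (eq_bigr (fun i => \sum_(u in S) (u \in F i))); last first.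
  move=> i iP; rewrite -sum1_card big_mkcond [RHS]big_mkcond /=.
  apply: eq_bigr => u _; case uF : (u \in F i); last by case: ifP.
  by rewrite (subsetP (FS i iP)).
rewrite exchange_big /= -sum1_card; apply: leq_sum => u uS.
rewrite -big_mkcondr sum1_card; apply/card_le1_eqP => i j.
by rewrite /in_mem /= => /andP[iP ui] /andP[jP uj]; exact: (Fdis j i u).
Qed.

Section Blocks.
Variables (T : finType).
Implicit Types X Y A B Z : {set T}.

Lemma card_setDU X A B : A \subset X -> B \subset ~: X -> #|A| = #|B| ->
  #|(X :\: A) :|: B| = #|X|.
Proof.
move=> AX BX AB; rewrite cardsU cardsD (setIidPr AX).
rewrite (_ : _ :&: B = set0) ?cards0; last first.
  apply/setP => x; rewrite !inE; apply/negP => /andP[/andP[_ xX] xB].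
  by have := subsetP BX x xB; rewrite inE xX.
by have := subset_leq_card AX; lia.
Qed.

Lemma card_setD_setDU X A B Y : A \subset X -> B \subset ~: X ->
  #|Y :\: ((X :\: A) :|: B)| = #|Y :&: A| + #|(Y :\: X) :\: B|.
Proof.
move=> AX BX; rewrite -cardsUI.
rewrite [X in _ = _ + X](_ : _ = 0) ?addn0; last first.
  apply/eqP; rewrite cards_eq0; apply/eqP/setP => x; rewrite !inE.
  by have := subsetP AX x; case: (x \in A) => // [->|]; rewrite ?andbF.
congr #|pred_of_set _|; apply/setP => x; rewrite !inE.
have /implyP := subsetP AX x; have /implyP := subsetP BX x; rewrite !inE.
by case: (x \in A); case: (x \in B); case: (x \in X); case: (x \in Y).
Qed.

Lemma card_setD_sym X Y : #|X| = #|Y| -> #|X :\: Y| = #|Y :\: X|.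
Proof. by move=> XY; rewrite !cardsD XY setIC. Qed.

End Blocks.

Section Perfect.
Variables (n w e : nat) (C : {set {set 'I_n}}).
Hypothesis perfC : perfect_code w e C.
Implicit Types X Y Z A B : {set 'I_n}.

Lemma code_card X : X \in C -> #|X| = w.
Proof.
by case: perfC => /subsetP CJ _ _ /CJ; rewrite inE => /eqP.
Qed.

Lemma perfect_cover Z : #|Z| = w -> exists2 X, X \in C & #|X :\: Z| <= e.
Proof.
move=> Zw; case: perfC => _ _ /and3P[/eqP cov _ _].
have : Z \in johnson n w by rewrite inE Zw.
rewrite -cov => /bigcupP[_ /imsetP[X XC ->]]; rewrite inE => /andP[_ XZ].
by exists X.
Qed.

Lemma perfect_unique X Y Z : X \in C -> Y \in C -> #|Z| = w ->
  #|X :\: Z| <= e -> #|Y :\: Z| <= e -> X = Y.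
Proof.
move=> XC YC Zw XZ YZ; case: perfC => _ inj /and3P[_ triv _].
apply: inj => //; apply: contraTeq (triv) => neq.
apply/negP => /trivIsetP tr; have := tr _ _ (imset_f _ XC) (imset_f _ YC) neq.
by move/pred0P/(_ Z); rewrite /= !inE Zw eqxx XZ YZ.
Qed.

(** If the distance is at most [2 * e], replacing half of [X :\: Y] with as many
    points of [Y :\: X] gives a word within distance [e] of both codewords. *)
Lemma perfect_dist X Y : X \in C -> Y \in C -> X != Y -> 2 * e < #|X :\: Y|.
Proof.
move=> XC YC; apply: contraNltn => XY; apply/eqP.
have Xw := code_card XC; have Yw := code_card YC.
have YX : #|X :\: Y| = #|Y :\: X| by apply: card_setD_sym; rewrite Xw.
set k := #|X :\: Y| in XY YX.
have [A AXY Ak] : exists2 A : {set 'I_n}, A \subset X :\: Y & #|A| = k./2.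
  by apply: exists_subset_card; rewrite -/k; lia.
have [B BYX Bk] : exists2 B : {set 'I_n}, B \subset Y :\: X & #|B| = k./2.
  by apply: exists_subset_card; rewrite -YX; lia.
have AX : A \subset X := subset_trans AXY (subsetDl _ _).
have BX : B \subset ~: X.
  by apply: subset_trans BYX _; rewrite setDE subsetIr.
apply: (@perfect_unique X Y ((X :\: A) :|: B)) => //.
- by rewrite card_setDU ?Ak ?Bk.
- rewrite card_setD_setDU // setDv set0D cards0 (setIidPr AX) Ak; lia.
- rewrite card_setD_setDU // cardsD (setIidPr BYX) Bk -YX.
  rewrite (_ : Y :&: A = set0) ?cards0; first by lia.
  apply/setP => x; rewrite !inE; apply/negP => /andP[xY xA].
  by have := subsetP AXY x xA; rewrite !inE xY.
Qed.

(** The word [X :\: A :|: B] lies at distance [e + 1] from [X], so another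
    codeword [Y] covers it; since [Y] is at distance at least [2 * e + 1] from
    [X], every inequality on the way is tight. *)
Lemma extension_exists X A B : X \in C -> A \subset X -> B \subset ~: X ->
    #|A| = e.+1 -> #|B| = e.+1 ->
  exists Y, [/\ Y \in C, A \subset X :\: Y, B \subset Y :\: X
              & #|X :\: Y| = (2 * e).+1].
Proof.
move=> XC AX BX Ae Be; set Z := (X :\: A) :|: B.
have Zw : #|Z| = w by rewrite card_setDU ?Ae ?Be ?code_card.
have [Y YC YZ] := perfect_cover Zw.
have XY : X != Y.
  apply: contraTneq YZ => <-; rewrite card_setD_setDU // (setIidPr AX) Ae.
  by rewrite -ltnNge; lia.
have := perfect_dist XC YC XY.
have symd : #|X :\: Y| = #|Y :\: X| by apply: card_setD_sym; rewrite !code_card.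
rewrite symd => dXY; rewrite card_setD_setDU // in YZ.
have cYX := cardsID B (Y :\: X).
have cB := subset_leq_card (subsetIr (Y :\: X) B).
have YB : #|(Y :\: X) :&: B| = #|B| by lia.
have YA : #|Y :&: A| = 0 by lia.
exists Y; split=> //; last by lia.
- rewrite subsetD AX /= disjoint_sym -setI_eq0.
  by rewrite -cards_eq0 YA.
- by apply/setIidPr/eqP; rewrite eqEcard subsetIr YB /=.
Qed.

(** For codewords at distance [2 * e + 1] from [X], a large overlap of the two
    pairs of difference sets brings them within distance [2 * e]. *)
Lemma extension_unique X Y Y' : X \in C -> Y \in C -> Y' \in C ->
    #|X :\: Y| = (2 * e).+1 -> #|X :\: Y'| = (2 * e).+1 ->
    2 * e + 2 <= #|(X :\: Y) :&: (X :\: Y')| + #|(Y :\: X) :&: (Y' :\: X)| ->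
  Y = Y'.
Proof.
move=> XC YC Y'C dY dY' big; apply/eqP; apply: contraTT big => neq.
have := perfect_dist YC Y'C neq.
have sY : #|X :\: Y| = #|Y :\: X| by apply: card_setD_sym; rewrite !code_card.
have eX : (Y :\: Y') :&: X = (X :\: Y') :\: (X :\: Y).
  by apply/setP => x; rewrite !inE; case: (x \in X); case: (x \in Y); case: (x \in Y').
have eN : (Y :\: Y') :\: X = (Y :\: X) :\: (Y' :\: X).
  by apply/setP => x; rewrite !inE; case: (x \in X); case: (x \in Y); case: (x \in Y').
rewrite -(cardsID X (Y :\: Y')) eX eN.
have := cardsID (X :\: Y) (X :\: Y'); have := cardsID (Y' :\: X) (Y :\: X).
by rewrite [(X :\: Y') :&: _]setIC -sY dY dY' -ltnNge; lia.
Qed.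

(** Fix [A] of size [e + 1] in [X] and [B] of size [e] outside [X].  The
    extensions [Y] of the pairs [(A, b |: B)] satisfy: the sets
    [Y :\: X :\: B], of size [e + 1], cover the remaining [n - w - e] points
    outside [X], while the sets [X :\: Y :\: A], of size [e], are disjoint and
    lie among the [w - (e + 1)] points of [X :\: A].  Comparing the two counts
    of these [Y] gives the bound. *)
Lemma roos_bound : e < w -> e < n - w -> C != set0 ->
  e * (n - w - e) <= e.+1 * (w - e.+1).
Proof.
move=> ew en /set0Pn[X XC]; have Xw := code_card XC.
have XcE : #|~: X| = n - w by rewrite cardsCs setCK card_ord Xw.
have [A AX Ae] : exists2 A : {set 'I_n}, A \subset X & #|A| = e.+1.
  by apply: exists_subset_card; rewrite Xw.
have [B BX Be] : exists2 B : {set 'I_n}, B \subset ~: X & #|B| = e.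
  by apply: exists_subset_card; rewrite XcE; lia.
pose ext b Y := [&& Y \in C, A \subset X :\: Y, b |: B \subset Y :\: X
                  & #|X :\: Y| == (2 * e).+1].
pose g b := odflt X [pick Y | ext b Y].
set U := (~: X) :\: B.
have extg b : b \in U -> ext b (g b).
  rewrite !inE => /andP[bB bX]; rewrite /g; case: pickP => //= noY.
  have [] := @extension_exists X A (b |: B) XC AX _ Ae.
  - by rewrite subUset sub1set inE bX.
  - by rewrite cardsU1 bB Be.
  - by move=> Y [YC AY BY dY]; have := noY Y; rewrite /ext YC AY BY dY eqxx.
set F := g @: U.
have FP Y : Y \in F -> [/\ Y \in C, A \subset X :\: Y, B \subset Y :\: X
                  & #|X :\: Y| = (2 * e).+1].
  case/imsetP => b /extg /and4P[YC AY BY /eqP dY] ->; split=> //.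
  by apply: subset_trans BY; exact: subsetUr.
have cardU : #|U| <= #|F| * e.+1.
  rewrite -sum1_card (partition_big_imset g) /= -/F -sum_nat_const.
  apply: leq_sum => Y YF; have [YC AY BY dY] := FP _ YF.
  rewrite sum1_card.
  apply: (@leq_trans #|(Y :\: X) :\: B|).
    apply: subset_leq_card; apply/subsetP => b; rewrite inE => /andP[bU /eqP gY].
    move: (bU); rewrite !inE => /andP[-> ->] /=; rewrite -gY.
    have /and4P[_ _ /subsetP/(_ b)] := extg _ bU.
    by rewrite !inE eqxx /= => /(_ isT) /andP[_ ->].
  rewrite cardsD (setIidPr BY) Be (card_setD_sym (X := Y)) ?dY ?code_card //.
  lia.
have cardF : #|F| * e <= #|X :\: A|.
  rewrite -sum_nat_const.
  rewrite (eq_bigr (fun Y => #|(X :\: Y) :\: A|)); last first.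
    move=> Y /FP[YC AY BY dY]; rewrite cardsD (setIidPr AY) dY Ae; lia.
  apply: sum_card_disjoint => [Y YF|Y Y' u YF Y'F].
    by apply: setSD; exact: subsetDl.
  have [YC AY BY dY] := FP _ YF; have [Y'C AY' BY' dY'] := FP _ Y'F.
  rewrite !inE => /and3P[uA uY uX] /and3P[_ uY' _].
  apply: (extension_unique XC YC Y'C dY dY').
  have : u |: A \subset (X :\: Y) :&: (X :\: Y').
    by rewrite subUset sub1set !inE uY uX uY' subsetI AY.
  have : B \subset (Y :\: X) :&: (Y' :\: X) by rewrite subsetI BY.
  move=> /subset_leq_card; rewrite Be => h1 /subset_leq_card.
  by rewrite cardsU1 uA Ae => h2; apply: leq_trans (leq_add h2 h1); clear; lia.
move: cardU cardF; rewrite /U !cardsD (setIidPr BX) (setIidPr AX) XcE Xw Ae Be.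
by clear -ew en; nia.
Qed.

(** Fix [A] of size [e - 1] in [X] and [B] of size [e + 1] outside [X].  For the
    codewords [Y] at distance [2 * e + 1] from [X] with [A] in [X :\: Y] and [B]
    in [Y :\: X], the sets [X :\: Y :\: A] are the lines of a linear space on
    [X :\: A]: any two points lie on a unique line, and lines have [e + 2]
    points.  The lines joining a point [z] off a line to the points of this line
    are distinct, so apart from [z] they have [(e + 2) * (e + 1)] points. *)
Lemma fisher_bound : 0 < e -> (2 * e).+1 < w -> e < n - w -> C != set0 ->
  e ^ 2 + 4 * e + 2 <= w.
Proof.
move=> e0 ew en /set0Pn[X XC]; have Xw := code_card XC.
have XcE : #|~: X| = n - w by rewrite cardsCs setCK card_ord Xw.
have [A1 A1X A1e] : exists2 A : {set 'I_n}, A \subset X & #|A| = e.+1.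
  by apply: exists_subset_card; rewrite Xw; lia.
have [B BX Be] : exists2 B : {set 'I_n}, B \subset ~: X & #|B| = e.+1.
  by apply: exists_subset_card; rewrite XcE; lia.
have [Y [YC _ BY dY]] := extension_exists XC A1X BX A1e Be.
have [z zX zY] : exists2 z, z \in X & z \in Y.
  have : 0 < #|X :&: Y|.
    by have := cardsID Y X; rewrite dY Xw; lia.
  by case/card_gt0P => z; rewrite inE => /andP[]; exists z.
have [A AXY Ae] : exists2 A : {set 'I_n}, A \subset X :\: Y & #|A| = e.-1.
  by apply: exists_subset_card; rewrite dY; lia.
have AX : A \subset X := subset_trans AXY (subsetDl _ _).
have zA : z \notin A.
  by apply/negP => /(subsetP AXY); rewrite !inE zY.
set V := (X :\: Y) :\: A.
pose ext y Y' := [&& Y' \in C, y |: (z |: A) \subset X :\: Y',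
                  B \subset Y' :\: X & #|X :\: Y'| == (2 * e).+1].
pose g y := odflt X [pick Y' | ext y Y'].
have cardzA : #|z |: A| = e by rewrite cardsU1 zA Ae add1n prednK.
have extg y : y \in V -> ext y (g y).
  rewrite !inE => /and3P[yA yY yX]; rewrite /g; case: pickP => //= noY.
  have [] := @extension_exists X (y |: (z |: A)) B XC _ BX _ Be.
  - by rewrite !subUset !sub1set yX zX.
  - rewrite cardsU1 cardzA !inE negb_or yA andbT.
    by case: (y =P z) yY => [->|]; rewrite ?zY.
  - by move=> Y' [YC' AY BY' dY']; have := noY Y'; rewrite /ext YC' AY BY' dY' eqxx.
have : \sum_(y in V) #|(X :\: g y) :\: (z |: A)| <= #|X :\: (z |: A)|.
  apply: sum_card_disjoint => [y yV|y y' u yV y'V].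
    by apply: setSD; exact: subsetDl.
  have /and4P[gC gA gB /eqP dg] := extg _ yV.
  have /and4P[g'C g'A g'B /eqP dg'] := extg _ y'V.
  rewrite !in_setD => /and3P[uA ug uX] /and3P[_ ug' _].
  have gg' : g y = g y'.
    apply: (extension_unique XC gC g'C dg dg').
    have : u |: (z |: A) \subset (X :\: g y) :&: (X :\: g y').
      rewrite subUset sub1set !in_setI !in_setD ug uX ug' /= subsetI.
      by rewrite (subset_trans _ gA) ?subsetUr // (subset_trans _ g'A) ?subsetUr.
    have : B \subset (g y :\: X) :&: (g y' :\: X) by rewrite subsetI gB.
    move=> /subset_leq_card; rewrite Be => h1 /subset_leq_card.
    by rewrite cardsU1 uA cardzA => h2; apply: leq_trans (leq_add h2 h1); clear; lia.
  apply/eqP; apply: contraT => neq.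
  have : Y = g y.
    apply: (extension_unique XC YC gC dY dg).
    have : y |: (y' |: A) \subset (X :\: Y) :&: (X :\: g y).
      rewrite !in_setD in yV y'V; case/and3P: yV => yA yY yX.
      case/and3P: y'V => y'A y'Y y'X.
      rewrite !subUset !sub1set !in_setI !in_setD yY yX y'Y y'X subsetI AXY /=.
      move: gA; rewrite !subUset !sub1set !in_setD.
      case/and3P => /andP[-> _] _ ->.
      by move: g'A; rewrite -gg' !subUset !sub1set !in_setD => /andP[/andP[-> _] _].
    have : B \subset (Y :\: X) :&: (g y :\: X) by rewrite subsetI BY.
    move=> /subset_leq_card; rewrite Be => h1 /subset_leq_card.
    rewrite cardsU1 cardsU1 !in_setU1 negb_or neq.
    move: yV y'V; rewrite !in_setD => /andP[-> _] /andP[-> _].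
    by rewrite Ae => h2; apply: leq_trans (leq_add h2 h1); clear; lia.
  move=> Yg; move: gA; rewrite -Yg => /subsetP/(_ z).
  by rewrite !inE eqxx orbT zY => /(_ isT).
rewrite (eq_bigr (fun => e.+1)); last first.
  move=> y /extg /and4P[_ gA _ /eqP dg]; rewrite cardsD (setIidPr _).
    by rewrite dg cardzA; clear; lia.
  by apply: subset_trans gA; exact: subsetUr.
rewrite sum_nat_const /V cardsD (setIidPr AXY) dY Ae cardsD (setIidPr _) ?Xw ?cardzA.
  by clear -e0 ew; nia.
by rewrite subUset sub1set zX.
Qed.

(** Two codewords force [2 * e + 1 <= w].  In case of equality distinct
    codewords are disjoint, and [roos_bound] leaves no room for a third. *)
Lemma nontrivial_width : ~ trivial_code w e C -> 2 * w <= n ->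
  (2 * e).+1 < w.
Proof.
move=> ntriv wn.
have e0 : 0 < e by rewrite lt0n; apply/eqP => e0; apply: ntriv; constructor 1.
have [Z0 _ Z0w] : exists2 Z : {set 'I_n}, Z \subset setT & #|Z| = w.
  by apply: exists_subset_card; rewrite cardsT card_ord; lia.
have [X XC _] := perfect_cover Z0w; have Xw := code_card XC.
have [Y YC YX] : exists2 Y, Y \in C & X != Y.
  have : ~~ (C \subset [set X]).
    apply/negP => CX; apply: ntriv; constructor 2.
    apply/eqP; rewrite eqn_leq (leq_trans (subset_leq_card CX)) ?cards1 //.
    by apply/card_gt0P; exists X.
  by case/subsetPn => Y YC; rewrite inE eq_sym; exists Y.
have leDw Y' : #|X :\: Y'| <= w.
  by rewrite -Xw subset_leq_card // subsetDl.
have := leDw Y; have := perfect_dist XC YC YX.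
rewrite leq_eqVlt => d1 d2; have {d1 d2} : 2 * e < w by lia.
rewrite leq_eqVlt => /orP[/eqP we|//]; case: ntriv.
have nE : n = 2 * w.
  have : e * (n - w - e) <= e.+1 * (w - e.+1).
    by apply: roos_bound; [lia|lia|apply/set0Pn; exists X].
  by rewrite -we; nia.
constructor 3; split=> //; first by lia.
exists X; first by rewrite inE Xw.
have compl Y' : Y' \in C -> X != Y' -> Y' = ~: X.
  move=> Y'C neq; have := perfect_dist XC Y'C neq; have := leDw Y' => l1 l2.
  apply/eqP; rewrite eqEcard cardsCs setCK card_ord Xw (code_card Y'C).
  apply/andP; split; last by lia.
  have XY' : X :\: Y' = X.
    by apply/eqP; rewrite eqEcard subsetDl Xw; lia.
  apply/subsetP => x xY'; rewrite inE; apply/negP => xX.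
  by move: xX; rewrite -XY' inE xY'.
apply/setP => Y'; rewrite !inE; apply/idP/orP.
  move=> Y'C; have [->|neq] := eqVneq Y' X; first by left.
  by right; rewrite (compl Y') // eq_sym.
by case=> /eqP-> //; rewrite -(compl Y).
Qed.

End Perfect.

(** * Exchanges and balls in the Johnson graph *)

Section Exchange.
Variable (T : finType).
Implicit Types (X Y : {set T}) (p q : T).

Definition exchange Y p q : {set T} := q |: (Y :\ p).

Lemma exchangeK Y p q : p \in Y -> q \notin Y ->
  exchange (exchange Y p q) q p = Y.
Proof.
move=> pY qY; apply/setP => x; rewrite !inE.
case: eqVneq => [->|_]; first by rewrite pY.
by case: eqVneq => [->|_] //=; apply/esym/negbTE.
Qed.

Lemma card_exchange Y p q : p \in Y -> q \notin Y -> #|exchange Y p q| = #|Y|.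
Proof.
move=> pY qY; rewrite cardsU1 !inE (negbTE qY) andbF /= [RHS](cardsD1 p) pY.
by [].
Qed.

Lemma exchange_in Y p q : q \in exchange Y p q.
Proof. by rewrite !inE eqxx. Qed.

Lemma exchange_notin Y p q : p \in Y -> q \notin Y -> p \notin exchange Y p q.
Proof.
by move=> pY qY; rewrite !inE eqxx /= orbF; apply: contraTneq pY => ->.
Qed.

Lemma card_setD_exchange X Y p q : p \in Y -> q \notin Y ->
  #|X :\: exchange Y p q| + (q \in X) = #|X :\: Y| + (p \in X).
Proof.
move=> pY qY; have pq : p != q by apply: contraTneq pY => ->.
rewrite (cardsD1 p (X :\: exchange Y p q)) (cardsD1 q (X :\: Y)).
rewrite !inE qY eqxx pY (negbTE pq) /=.
suff -> : (X :\: exchange Y p q) :\ p = (X :\: Y) :\ q by lia.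
apply/setP => x; rewrite !inE.
case: (eqVneq x p) => [->|_]; first by rewrite pY andbF.
by case: (eqVneq x q) => [->|_] //=; rewrite andbF.
Qed.

(** Reversing an exchange turns the sum over the oriented edges of the Johnson
    graph around: its adjacency operator is self-adjoint. *)
Lemma exchange_sum_sym (R : nmodType) (P : pred {set T})
    (G : {set T} -> {set T} -> R) :
  (forall Y p q, p \in Y -> q \notin Y -> P (exchange Y p q) = P Y) ->
  (\sum_(Y | P Y) \sum_(p in Y) \sum_(q in ~: Y) G Y (exchange Y p q) =
   \sum_(Y | P Y) \sum_(p in Y) \sum_(q in ~: Y) G (exchange Y p q) Y)%R.
Proof.
move=> PE.
have flat F : (\sum_(Y | P Y) \sum_(p in Y) \sum_(q in ~: Y) F Y p q =
   \sum_(u : {set T} * T * T | P u.1.1 && (u.1.2 \in u.1.1) && (u.2 \notin u.1.1))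
     (F u.1.1 u.1.2 u.2 : R))%R.
  under eq_bigr => Y _ do under eq_bigr => p _ do
    under eq_bigl => q do rewrite inE.
  rewrite pair_big_dep /= (pair_big_dep _ (fun (u : {set T} * T) q => q \notin u.1)) /=.
  by [].
rewrite !flat.
pose h (u : {set T} * T * T) := (exchange u.1.1 u.1.2 u.2, u.2, u.1.2).
rewrite (reindex_onto h h) /=; last first.
  by move=> [[Y p] q] /= /andP[/andP[_ pY] qY]; rewrite /h /= exchangeK.
apply: eq_big => [[[Y p] q] /=|[[Y p] q] /=].
  rewrite exchange_in andbT; apply/idP/idP.
    case/andP => /andP[PY' pY'] /eqP[EY].
    have pq : p != q by apply: contraNneq pY' => ->; exact: exchange_in.
    have pY : p \in Y by rewrite -EY exchange_in.
    have qY : q \notin Y by rewrite -EY !inE eqxx orbF eq_sym.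
    by rewrite pY qY -(PE Y p q) // PY'.
  case/andP => /andP[PY pY] qY.
  by rewrite PE // PY exchange_notin //= /h /= exchangeK.
by case/andP => _ /eqP[EY]; rewrite EY.
Qed.
End Exchange.

Lemma johnson_ball0 n w (X : {set 'I_n}) : #|X| = w ->
  johnson_ball w 0 X = [set X].
Proof.
move=> Xw; apply/setP => Y.
rewrite !inE /johnson_dist leqn0 cards_eq0 setD_eq0.
apply/andP/eqP => [[/eqP Yw XY]|->]; last by rewrite Xw eqxx subxx.
by apply/esym/eqP; rewrite eqEcard XY Yw Xw leqnn.
Qed.

Section BallRecurrence.
Local Open Scope ring_scope.
Variables (n w : nat) (f : {set 'I_n} -> int) (kappa : int).
Hypothesis wn : (w <= n)%N.
Hypothesis feigen : forall Y : {set 'I_n}, #|Y| = w ->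
  \sum_(p in Y) \sum_(q in ~: Y) f (exchange Y p q) = kappa * f Y.
Variable X : {set 'I_n}.
Hypothesis Xw : #|X| = w.

Let dist (Y : {set 'I_n}) := #|X :\: Y|.

Lemma sum_mem (T : finType) (A B : {set T}) :
  \sum_(p in A) (p \in B)%:Z = #|A :&: B|%:Z.
Proof.
rewrite (eq_bigr (fun p => if p \in B then 1%:Z else 0)); last first.
  by move=> p _; case: (p \in B).
by rewrite -big_mkcondr sumr_const -mulr_natl mulr1 -cardsE natz.
Qed.

(** The number of neighbours of [Y] in the ball of radius [i] around [X]: an
    exchange changes the distance by at most one, so only words at distance [i] or
    [i + 1] can have neighbours both inside and outside. *)
Lemma degree_in_ball (Y : {set 'I_n}) (i : nat) : #|Y| = w ->
  \sum_(p in Y) \sum_(q in ~: Y) (dist (exchange Y p q) <= i)%N%:Z =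
    w%:Z * (n - w)%:Z * (dist Y <= i)%N%:Z
    - (w%:Z - i%:Z) * ((n - w)%:Z - i%:Z) * (dist Y == i)%:Z
    + i.+1%:Z ^+ 2 * (dist Y == i.+1)%:Z.
Proof.
move=> Yw; have YX : #|Y :\: X| = dist Y.
  by rewrite /dist !cardsD setIC Yw Xw.
have YIX : #|Y :&: X|%:Z = w%:Z - (dist Y)%:Z.
  by have := cardsID X Y; rewrite YX Yw; lia.
have cYX : #|~: Y :&: X| = dist Y by rewrite setIC -setDE.
have cYcX : #|~: Y :&: ~: X|%:Z = (n - w)%:Z - (dist Y)%:Z.
  have := cardsID X (~: Y); rewrite cYX setDE.
  by rewrite [#|~: Y|]cardsCs setCK card_ord Yw; lia.
have dE p q : p \in Y -> q \in ~: Y ->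
    (dist (exchange Y p q) + (q \in X) = dist Y + (p \in X))%N.
  by rewrite inE => pY qY; apply: card_setD_exchange.
have prodsum (A B : {set 'I_n}) : \sum_(p in Y) \sum_(q in ~: Y)
    ((p \in A)%:Z * (q \in B)%:Z) = #|Y :&: A|%:Z * #|~: Y :&: B|%:Z.
  by rewrite -!sum_mem mulr_suml; apply: eq_bigr => p _; rewrite mulr_sumr.
have cst (c : int) : \sum_(p in Y) \sum_(q in ~: Y) c = w%:Z * (n - w)%:Z * c.
  rewrite sumr_const sumr_const [#|~: Y|]cardsCs setCK card_ord Yw.
  by rewrite -mulrnA -mulr_natl natz PoszM; ring.
case: (ltngtP (dist Y) i) => [di|di|di].
- rewrite (eq_bigr (fun=> \sum_(q in ~: Y) 1%:Z)); last first.
    move=> p pY; apply: eq_bigr => q qY; have := dE p q pY qY.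
    by case: leqP => //; case: (p \in X); case: (q \in X); lia.
  by rewrite cst (_ : (dist Y == i.+1) = false); lia.
- case: (dist Y =P i.+1) => [di1|di1].
    rewrite (eq_bigr (fun p => \sum_(q in ~: Y)
       ((p \in ~: X)%:Z * (q \in X)%:Z))); last first.
      move=> p pY; apply: eq_bigr => q qY; have := dE p q pY qY.
      by rewrite inE; case: leqP => //; case: (p \in X); case: (q \in X); lia.
    by rewrite prodsum -setDE YX cYX di1 /=; ring.
  rewrite (eq_bigr (fun=> \sum_(q in ~: Y) 0%:Z)); last first.
    move=> p pY; apply: eq_bigr => q qY; have := dE p q pY qY.
    by case: leqP => //; case: (p \in X); case: (q \in X); lia.
  by rewrite cst /=; ring.
- rewrite (eq_bigr (fun p => \sum_(q in ~: Y) 1%:Z - \sum_(q in ~: Y)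
       ((p \in X)%:Z * (q \in ~: X)%:Z))); last first.
    move=> p pY; rewrite -sumrB; apply: eq_bigr => q qY; have := dE p q pY qY.
    by rewrite [q \in ~: X]inE; case: leqP => //; case: (p \in X); case: (q \in X); lia.
  rewrite sumrB cst prodsum YIX cYcX di (_ : (i == i.+1) = false); last by lia.
  by rewrite /=; ring.
Qed.

Definition ball_sum (i : nat) := \sum_(Y in johnson_ball w i X) f Y.

(** Evaluate in two ways the sum of [f] over the edges with the other end in the
    ball of radius [i]: by the eigenvalue equation, and by counting the
    neighbours of each word in the ball. *)
Lemma ball_recurrence (i : nat) :
  i.+1%:Z ^+ 2 * ball_sum i.+1 =
    (kappa - w%:Z * (n - w)%:Z + (w%:Z - i%:Z) * ((n - w)%:Z - i%:Z)
      + i.+1%:Z ^+ 2) * ball_sum i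
    - (w%:Z - i%:Z) * ((n - w)%:Z - i%:Z)
      * (if i is j.+1 then ball_sum j else 0).
Proof.
have bsE j : ball_sum j = \sum_(Y : {set 'I_n} | #|Y| == w) (dist Y <= j)%N%:Z * f Y.
  rewrite /ball_sum big_mkcond [RHS]big_mkcond /=; apply: eq_bigr => Y _.
  rewrite !inE /johnson_dist -/(dist Y).
  by case: (_ == w) => //=; case: (_ <= j)%N; rewrite ?mul1r ?mul0r.
pose S j := \sum_(Y : {set 'I_n} | #|Y| == w) (dist Y == j)%:Z * f Y.
have bsS j : ball_sum j = (if j is k.+1 then ball_sum k else 0) + S j.
  case: j => [|j]; rewrite !bsE /S ?add0r -?big_split /=; apply: eq_bigr => Y _.
    by rewrite leqn0.
  by rewrite -mulrDl; congr (_ * _); lia.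
have sym : \sum_(Y : {set 'I_n} | #|Y| == w) \sum_(p in Y) \sum_(q in ~: Y)
      (dist Y <= i)%N%:Z * f (exchange Y p q)
    = \sum_(Y : {set 'I_n} | #|Y| == w) \sum_(p in Y) \sum_(q in ~: Y)
      (dist (exchange Y p q) <= i)%N%:Z * f Y.
  apply: (exchange_sum_sym (fun Y Z => (dist Y <= i)%N%:Z * f Z)) => Y p q pY qY.
  by rewrite card_exchange.
have lhs : \sum_(Y : {set 'I_n} | #|Y| == w) \sum_(p in Y) \sum_(q in ~: Y)
      (dist Y <= i)%N%:Z * f (exchange Y p q) = kappa * ball_sum i.
  rewrite bsE mulr_sumr; apply: eq_bigr => Y /eqP Yw.
  under eq_bigr => p _ do rewrite -mulr_sumr.
  by rewrite -mulr_sumr feigen // mulrCA.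
have rhs : \sum_(Y : {set 'I_n} | #|Y| == w) \sum_(p in Y) \sum_(q in ~: Y)
      (dist (exchange Y p q) <= i)%N%:Z * f Y
    = w%:Z * (n - w)%:Z * ball_sum i
      - (w%:Z - i%:Z) * ((n - w)%:Z - i%:Z) * S i + i.+1%:Z ^+ 2 * S i.+1.
  rewrite bsE /S !mulr_sumr -sumrB -big_split; apply: eq_bigr => Y /eqP Yw.
  under eq_bigr => p _ do rewrite -mulr_suml.
  by rewrite -mulr_suml degree_in_ball //=; ring.
move: lhs; rewrite sym rhs; have := bsS i.+1; have := bsS i => /= E1 E2 E.
rewrite E2.
have -> : (if i is j.+1 then ball_sum j else 0) = ball_sum i - S i.
  by rewrite [X in X - _]E1 addrK.
have -> : i.+1%:Z ^+ 2 * (ball_sum i + S i.+1) = i.+1%:Z ^+ 2 * ball_sum i +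
  (kappa * ball_sum i - w%:Z * (n - w)%:Z * ball_sum i
      + (w%:Z - i%:Z) * ((n - w)%:Z - i%:Z) * S i) by rewrite -E; ring.
by ring.
Qed.
End BallRecurrence.

(** * Eigenfunctions of the Johnson graph *)

Section PairFunction.
Local Open Scope ring_scope.
Variable T : finType.
Implicit Types (X Y : {set T}) (l : seq (T * T)).

Definition points l : seq T := flatten [seq [:: u.1; u.2] | u <- l].

(** For disjoint pairs of points, these functions span the eigenspace of the
    Johnson graph with index [size l]. *)
Definition pair_fun l X : int := \prod_(u <- l) ((u.1 \in X)%:Z - (u.2 \in X)%:Z).

Definition mate l x y := ((x, y) \in l) || ((y, x) \in l).

Lemma mate_points l x y : mate l x y -> (x \in points l) && (y \in points l).
Proof.
by case/orP => h; apply/andP; split; apply/flattenP;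
  (eexists; [exact: map_f h | rewrite !inE eqxx ?orbT]).
Qed.

Lemma mate_exists l x : x \in points l -> exists y, mate l x y.
Proof.
case/flattenP => _ /mapP[[a b] ab ->]; rewrite !inE /= => /orP[]/eqP->.
  by exists b; rewrite /mate ab.
by exists a; rewrite /mate ab orbT.
Qed.

Lemma pair_fun_eq l X Y :
  {in points l, forall x, (x \in X) = (x \in Y)} -> pair_fun l X = pair_fun l Y.
Proof.
rewrite /pair_fun => XY; rewrite !big_seq; apply: eq_bigr => -[a b] /= ab.
have /andP[al bl] : (a \in points l) && (b \in points l).
  by apply: mate_points; rewrite /mate ab.
by rewrite !XY.
Qed.

Lemma pair_fun0 l X x y : mate l x y -> (x \in X) = (y \in X) -> pair_fun l X = 0.
Proof.
by case/orP => xyl xy; rewrite /pair_fun (big_rem _ xyl) /= xy subrr mul0r.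
Qed.

Lemma pair_fun_flip l X Y x y : uniq (points l) -> mate l x y ->
    (x \in Y) = (y \in X) -> (y \in Y) = (x \in X) ->
    (forall z, z != x -> z != y -> (z \in Y) = (z \in X)) ->
  pair_fun l Y = - pair_fun l X.
Proof.
move=> ul xyl xY yY off.
wlog xyl' : x y {xyl} xY yY off / (x, y) \in l.
  move=> H; case/orP: xyl => [|yxl]; first by move/H; apply.
  by apply: (H y x) => // z zy zx; apply: off.
have p := perm_to_rem xyl'; set l' := rem _ l in p.
have ul' : uniq (x :: y :: points l').
  by rewrite -(perm_uniq (perm_flatten (perm_map (fun u => [:: u.1; u.2]) p))).
rewrite /pair_fun !(perm_big _ p) /= !big_cons -!/(pair_fun _ _) /= xY yY.
rewrite (pair_fun_eq (X := Y) (Y := X)) -?mulNr ?opprB // => z zl'.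
move: ul' => /= /and3P[]; rewrite inE negb_or => /andP[_ xl'] yl' _.
by apply: off; [apply: contraNneq xl' | apply: contraNneq yl'] => <-.
Qed.

Lemma pair_fun_tperm l a b X : uniq (points l) -> (a, b) \in l ->
  pair_fun l (tperm a b @: X) = - pair_fun l X.
Proof.
move=> ul abl.
have im z : (z \in tperm a b @: X) = (tperm a b z \in X).
  by rewrite -{1}(tpermK a b z) mem_imset //; exact: perm_inj.
apply: (@pair_fun_flip _ _ _ a b) => //; rewrite ?im ?tpermL ?tpermR //.
  by rewrite /mate abl.
by move=> z za zb; rewrite im tpermD // eq_sym.
Qed.

Lemma card_points_half l X : uniq (points l) ->
    all (fun u => (u.1 \in X) != (u.2 \in X)) l ->
  #|X :&: [set x in points l]| = size l.
Proof.
move=> ul good.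
rewrite (_ : X :&: _ = [set x in [seq x <- points l | x \in X]]); last first.
  by apply/setP => x; rewrite !inE mem_filter.
rewrite cardsE; have /card_uniqP -> : uniq [seq x <- points l | x \in X].
  exact: filter_uniq.
elim: l {ul} good => [//|[a b] l IH] /= /andP[ab /IH].
by case: (a \in X) ab; case: (b \in X) => //= _ ->.
Qed.

(** If both or neither of [a], [b] are in [X] for some pair [(a, b)], the
    transposition of [a] and [b] fixes [X] and negates the function, so the sum
    vanishes.  Otherwise an exchange away from the points of [l] preserves the
    value, swapping the two points of a pair negates it, and any other exchange
    spoils a pair and yields zero. *)
Lemma pair_fun_eigen l X : uniq (points l) ->
  \sum_(p in X) \sum_(q in ~: X) pair_fun l (exchange X p q) =
  ((#|X|%:Z - (size l)%:Z) * (#|~: X|%:Z - (size l)%:Z) - (size l)%:Z)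
    * pair_fun l X.
Proof.
move=> ul; case: (boolP (all (fun u => (u.1 \in X) != (u.2 \in X)) l)); last first.
  case/allPn => -[a b] /= abl; rewrite negbK => /eqP ab.
  rewrite (pair_fun0 (_ : mate l a b) ab) ?mulr0 /mate ?abl //.
  set t := tperm a b; have tX z : (t z \in X) = (z \in X).
    by rewrite /t; case: tpermP => // ->.
  apply/eqP; rewrite -eqNr eq_sym; apply/eqP.
  rewrite [LHS](reindex_inj (@perm_inj _ t)) /= -sumrN.
  apply: eq_big => [p|p _]; first exact: tX.
  rewrite [LHS](reindex_inj (@perm_inj _ t)) /= -sumrN.
  apply: eq_big => [q|q _]; first by rewrite !inE tX.
  rewrite -(pair_fun_tperm _ ul abl) -/t; apply: pair_fun_eq => z _.
  rewrite -(tpermK a b z) -/t mem_imset; last exact: perm_inj.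
  by rewrite !inE !(inj_eq perm_inj) tX.
move=> good; set S := [set x in points l].
have cS : #|X :&: S| = size l := card_points_half ul good.
have cSc : #|~: X :&: S| = size l.
  apply: card_points_half => //; apply: sub_all good => u.
  by rewrite !inE; case: (_ \in X); case: (_ \in X).
have mateX x y : mate l x y -> (y \in X) = (x \notin X).
  by case/orP => /(allP good) /=; case: (x \in X); case: (y \in X).
have inner p : p \in X -> \sum_(q in ~: X) pair_fun l (exchange X p q) =
    (p \notin S)%:Z * ((#|~: X|%:Z - (size l)%:Z) * pair_fun l X)
    - (p \in S)%:Z * pair_fun l X.
  move=> pX; case: (boolP (p \in S)) => pS /=; last first.
    rewrite mul1r mul0r subr0 (bigID (mem S)) /= big1 ?add0r; last first.
      move=> q /andP[]; rewrite !inE => qX /mate_exists[r qr].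
      have rX : r \in X by rewrite (mateX _ _ qr).
      apply: pair_fun0 (qr) _; rewrite !inE eqxx rX andbT.
      suff -> : r != p by rewrite orbT.
      by apply: contraNneq pS => <-; case/andP: (mate_points qr); rewrite inE.
    rewrite (eq_bigr (fun=> pair_fun l X)); last first.
      move=> q /andP[_ qS]; apply: pair_fun_eq => z zl; rewrite !inE.
      have zS : z \in S by rewrite inE.
      have /negbTE-> : z != q by apply: contraNneq qS => <-.
      by have -> : z != p by apply: contraNneq pS => <-.
    rewrite sumr_const -mulr_natl natz; congr (_ * _).
    rewrite -cSc subzn ?subset_leq_card ?subsetIl // -cardsD.
    by congr (Posz _); apply: eq_card => q; rewrite [LHS]unfold_in /= !inE andbC.
  have [r pr] : exists r, mate l p r by apply: mate_exists; rewrite inE in pS.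
  have rX : r \notin X by rewrite (mateX _ _ pr) pX.
  rewrite mul0r sub0r mul1r (bigD1 r) ?inE //= [X in _ + X]big1 ?addr0.
    apply: (pair_fun_flip ul pr).
    - by rewrite (negbTE rX) (negbTE (exchange_notin pX rX)).
    - by rewrite exchange_in pX.
    - by move=> z zp zr; rewrite !inE (negbTE zr) zp.
  move=> q; rewrite inE => /andP[qX qr]; apply: pair_fun0 (pr) _.
  rewrite (negbTE (exchange_notin pX qX)) !inE (eq_sym r q) (negbTE qr).
  by rewrite (negbTE rX) andbF.
rewrite (eq_bigr _ inner) sumrB -!mulr_suml.
under eq_bigr => p _ do rewrite -in_setC.
rewrite !sum_mem cS -setDE cardsD cS.
have := subset_leq_card (subsetIl X S); rewrite cS => lX.
by rewrite -subzn //; ring.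
Qed.

End PairFunction.

(** * Designs from vanishing pair sums *)

Section Design.
Variables (n w t : nat) (C : {set {set 'I_n}}).
Hypothesis Cw : forall X, X \in C -> #|X| = w.
Hypothesis sum0 : forall l : seq ('I_n * 'I_n),
  uniq (points l) -> 0 < size l <= t -> (\sum_(X in C) pair_fun l X = 0)%R.

Lemma card_outside_points (X S : {set 'I_n}) (l : seq ('I_n * 'I_n)) :
    uniq (points l) -> #|X| = w -> S \subset X ->
    (forall x, x \in S -> x \notin points l) -> pair_fun l X != 0%R ->
  #|X :&: ~: (S :|: [set x in points l])| + #|S| + size l = w.
Proof.
move=> ul Xw SX Sl fX.
have good : all (fun u => (u.1 \in X) != (u.2 \in X)) l.
  apply/allP => -[a b] abl /=; apply: contraNneq fX => ab.
  by rewrite (pair_fun0 (_ : mate l a b) ab) // /mate abl.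
rewrite -(card_points_half ul good).
have -> : X :&: ~: (S :|: [set x in points l]) = (X :\: [set x in points l]) :\: S.
  by apply/setP => x; rewrite !inE negb_or; do !case: (_ \in _).
have SXl : S \subset X :\: [set x in points l].
  by apply/subsetP => x xS; rewrite !inE Sl // (subsetP SX).
by rewrite cardsD (setIidPr SXl) subnK ?subset_leq_card // addnC cardsID.
Qed.

(** Induction on [S = z |: S']: by the induction hypothesis for the additional
    pair [(z, z')], the sum does not change when [z] is replaced with any other
    free point [z'].  Summing over all free points counts each codeword equally
    often, by [card_outside_points], and so gives a multiple of the sum for
    [S'], which is zero. *)
Lemma pair_sum_containing0 (S : {set 'I_n}) (l : seq ('I_n * 'I_n)) :
    uniq (points l) -> (forall x, x \in S -> x \notin points l) ->
    0 < size l -> #|S| + size l <= t ->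
  (\sum_(X in C) (S \subset X)%:Z * pair_fun l X = 0)%R.
Proof.
elim: {S}#|S| {-2}S (erefl #|S|) l => [|s IH] S Ss l ul Sl l0 lt.
  rewrite Ss in lt; apply: etrans (sum0 ul _); last by rewrite l0.
  by apply: eq_bigr => X _; rewrite (cards0_eq Ss) sub0set mul1r.
have [z zS] : exists z, z \in S by apply/set0Pn; rewrite -card_gt0 Ss.
set S' := S :\ z.
have S's : #|S'| = s by have := cardsD1 z S; rewrite zS Ss => -[].
have S'l x : x \in S' -> x \notin points l by rewrite inE => /andP[_ /Sl].
pose G z' := (\sum_(X in C) (z' |: S' \subset X)%:Z * pair_fun l X)%R.
set U := ~: (S' :|: [set x in points l]).
have zU : z \in U by rewrite !inE eqxx /= Sl.
have Gz z' : z' \in U -> G z' = G z.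
  rewrite !inE negb_or => /andP[z'S' z'l].
  have [->//|zz'] := eqVneq z' z.
  apply/eqP; rewrite -subr_eq0 -opprB oppr_eq0 -sumrB.
  apply/eqP; apply: etrans (IH S' S's ((z, z') :: l) _ _ _ _) => //=.
  - apply: eq_bigr => X _; rewrite /pair_fun big_cons /= !subUset !sub1set.
    by case: (z \in X); case: (z' \in X); case: (S' \subset X); rewrite /=; ring.
  - by rewrite inE eq_sym (negbTE zz') Sl //= z'l ul.
  - move=> x xS'; rewrite !inE !negb_or /= S'l // andbT.
    by apply/andP; split; [|apply: contraNneq z'S' => <-];
      move: xS'; rewrite !inE // => /andP[].
  - by rewrite S's; lia.
have sumG : (\sum_(z' in U) G z' = 0)%R.
  rewrite exchange_big /=.
  rewrite (eq_bigr (fun X : {set 'I_n} => (w%:Z - s%:Z - (size l)%:Z)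
     * ((S' \subset X)%:Z * pair_fun l X))%R); last first.
    move=> X XC; rewrite -mulr_suml.
    have [->|fX] := eqVneq (pair_fun l X) 0%R; first by rewrite !mulr0.
    rewrite mulrA; congr (_ * _)%R.
    case: (boolP (S' \subset X)) => S'X /=; last first.
      rewrite mulr0 big1 // => z' _; rewrite subUset (negbTE S'X) andbF //.
    rewrite (eq_bigr (fun z' => (z' \in X)%:Z%R)); last first.
      by move=> z' _; rewrite subUset S'X sub1set andbT.
    rewrite sum_mem setIC.
    by have := card_outside_points ul (Cw XC) S'X S'l fX; rewrite -/U S's; lia.
  by rewrite -mulr_sumr (IH S' S's l) ?mulr0 //; lia.
move/eqP: sumG; rewrite (eq_bigr (fun=> G z)) // sumr_const.
rewrite mulrn_eq0 => /orP[/eqP U0|/eqP G0].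
  by have : 0 < #|U| by [apply/card_gt0P; exists z]; rewrite U0.
by rewrite -[RHS]G0; apply: eq_bigr => X _; rewrite setD1K.
Qed.

(** With a single pair, [pair_sum_containing0] says that exchanging one point
    of a [t]-set preserves the number of codewords containing it. *)
Lemma pair_sums_design : is_design t C.
Proof.
pose c (T : {set 'I_n}) := #|[set X in C | T \subset X]|.
have cE T : ((c T)%:Z = \sum_(X in C) (T \subset X)%:Z)%R.
  rewrite (eq_bigr (fun X : {set 'I_n} => if T \subset X then 1 else 0)%R); last first.
    by move=> X _; case: (T \subset X).
  rewrite -big_mkcondr sumr_const -mulr_natl mulr1 natz.
  by congr (Posz _); apply: eq_card => X; rewrite inE.
have step (S : {set 'I_n}) z z' : #|S|.+1 = t -> z \notin S -> z' \notin S ->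
    c (z |: S) = c (z' |: S).
  move=> St zS z'S; have [->//|zz'] := eqVneq z z'.
  apply/eqP; rewrite -eqz_nat -subr_eq0 !cE -sumrB.
  have := @pair_sum_containing0 S [:: (z, z')].
  rewrite /= addn1 St inE zz' => /(_ isT) H; apply/eqP; apply: etrans (H _ _ _) => //.
    apply: eq_bigr => X _; rewrite /pair_fun big_seq1 /= !subUset !sub1set.
    by case: (z \in X); case: (z' \in X); case: (S \subset X).
  by move=> x xS; rewrite !inE negb_or /=; apply/andP; split;
    [apply: contraNneq zS => <-|apply: contraNneq z'S => <-].
have const (T T' : {set 'I_n}) : #|T| = t -> #|T'| = t -> c T = c T'.
  elim: {T}#|T :\: T'| {-2}T (erefl #|T :\: T'|) => [|k IH] T Tk Tt T't.
    have TT' : T \subset T' by rewrite -setD_eq0 (cards0_eq Tk).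
    by congr c; apply/eqP; rewrite eqEcard TT' Tt T't leqnn.
  have [z] : exists z, z \in T :\: T' by apply/set0Pn; rewrite -card_gt0 Tk.
  rewrite inE => /andP[zT' zT].
  have [z'] : exists z', z' \in T' :\: T.
    by apply/set0Pn; rewrite -card_gt0 -(card_setD_sym (X := T)) ?Tk // Tt T't.
  rewrite inE => /andP[z'T z'T'].
  have T1 : #|T :\ z| .+1 = t by rewrite -Tt (cardsD1 z T) zT.
  rewrite -(setD1K zT) (step _ z z') ?inE ?eqxx //; last by rewrite negb_and z'T orbT.
  apply: IH => //; last by rewrite cardsU1 inE (negbTE z'T) andbF.
  have -> : (z' |: T :\ z) :\: T' = (T :\: T') :\ z.
    apply/setP => x; rewrite !inE; case: (eqVneq x z') => [->|_] /=.
      by rewrite z'T' !andbF.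
    by rewrite andbCA.
  by have := cardsD1 z (T :\: T'); rewrite !inE zT zT' Tk => -[].
have [T /eqP Tt|noT] := pickP [pred T : {set 'I_n} | #|T| == t].
  by exists (c T) => T' T't; apply: const.
by exists 0 => T /eqP Tt; have := noT T; rewrite /= Tt.
Qed.
End Design.

(** One plus the eigenvalue of the Johnson graph on the functions [pair_fun l]
    with [size l = t].  The shift makes it the eigenvalue with index [t - 1] of
    the Johnson graph of the [(w - 1)]-subsets of [n - 2] points, in whose terms
    the recurrence below is the usual one for the spheres. *)
Definition lloyd_eigenvalue (n w t : nat) : int :=
  ((w%:Z - t%:Z) * ((n - w)%:Z - t%:Z) - t%:Z + 1)%R.

Section Lloyd.
Local Open Scope ring_scope.
Variables (n w e : nat) (C : {set {set 'I_n}}).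
Hypotheses (perfC : perfect_code w e C) (wn : (w <= n)%N).
Variable l : seq ('I_n * 'I_n).
Hypotheses (ul : uniq (points l)) (l0 : (0 < size l)%N).

Let th := lloyd_eigenvalue n w (size l).

Definition code_ball_sum i := \sum_(X in C) ball_sum w (pair_fun l) X i.

Lemma code_ball_sum0 : code_ball_sum 0 = \sum_(X in C) pair_fun l X.
Proof.
apply: eq_bigr => X XC.
by rewrite /ball_sum johnson_ball0 ?big_set1 ?(code_card perfC).
Qed.

(** The balls partition the [w]-sets, whose total is negated by the
    transposition of the two points of a pair. *)
Lemma code_ball_sum_perfect : code_ball_sum e = 0.
Proof.
have -> : code_ball_sum e = \sum_(Y in johnson n w) pair_fun l Y.
  case: perfC => _ inj part; rewrite (set_partition_big _ part) /= big_imset //=.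
case El : l l0 => [//|[a b] l'] _.
have abl : (a, b) \in l by rewrite El inE eqxx.
rewrite -El; apply/eqP; rewrite -eqNr eq_sym; apply/eqP.
rewrite [LHS](reindex_inj (imset_inj (@perm_inj _ (tperm a b)))) /= -sumrN.
apply: eq_big => [Y|Y _]; first by rewrite !inE card_imset //; exact: perm_inj.
by rewrite (pair_fun_tperm _ ul abl).
Qed.

Let feigen (Y : {set 'I_n}) : #|Y| = w ->
  \sum_(p in Y) \sum_(q in ~: Y) pair_fun l (exchange Y p q) =
    (th - 1) * pair_fun l Y.
Proof.
move=> Yw; rewrite pair_fun_eigen // [#|~: Y|]cardsCs setCK card_ord Yw.
rewrite /th /lloyd_eigenvalue.
by ring.
Qed.

Lemma code_ball_sum_recurrence (i : nat) :
  i.+1%:Z ^+ 2 * code_ball_sum i.+1 =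
     (th - i%:Z * ((w%:Z + (n - w)%:Z) - 2 - 2 * i%:Z)) * code_ball_sum i
     - (w%:Z - i%:Z) * ((n - w)%:Z - i%:Z)
       * (if i is j.+1 then code_ball_sum j else 0).
Proof.
have rec X (XC : X \in C) := ball_recurrence wn feigen (code_card perfC XC) i.
rewrite mulr_sumr (eq_bigr _ rec) {rec}.
case: i => [|i]; rewrite sumrB -!mulr_sumr ?big1_eq /code_ball_sum /th /lloyd_eigenvalue.
  by ring.
by ring.
Qed.
End Lloyd.

(** * Positivity of the ball eigenvalues *)

(** These inequalities are stated in [Z], whose numerals are binary: unary ones
    cannot accommodate the coefficients below. *)
Section Polynomials.
Local Open Scope Z_scope.

(** In terms of [a = i - 5] and the excess [s] of [n] over its bound, the
    difference of the two sides has nonnegative coefficients.  This fails for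
    smaller shifts of [i], so the values up to 4 are treated separately. *)
Lemma cubic_geZ (n i : Z) : 1 <= i -> 2 * i ^ 2 + 12 * i + 14 <= n ->
  8 * i * (n - 2 * i) ^ 2
    <= (n - 8 + 4 * i) * (n ^ 2 + 28 - 24 * (i - 1) * (n - 4)).
Proof.
move=> i1 hn.
have [s [s0 ->]] : exists s, 0 <= s /\ n = 2 * i ^ 2 + 12 * i + 14 + s.
  by exists (n - (2 * i ^ 2 + 12 * i + 14)); lia.
apply/Z.le_0_sub.
have [i4|i5] : i <= 4 \/ 5 <= i by lia.
  have : i = 1 \/ i = 2 \/ i = 3 \/ i = 4 by lia.
  by case=> [|[|[|]]] ->; nia.
have [a [a0 ->]] : exists a, 0 <= a /\ i = a + 5 by exists (i - 5); lia.
set lhs := (X in (0 <= X)).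
have -> : lhs =
 8384 + 15436 * s + 248 * s^2 + s^3 + 32080 * a + 8672 * (a * s)
 + 68 * (a * s^2) + 46392 * a^2 + 2208 * (a^2 * s) + 6 * (a^2 * s^2)
 + 19360 * a^3 + 272 * (a^3 * s) + 3424 * a^4 + 12 * (a^4 * s)
 + 272 * a ^ 5 + 8 * a^6 by rewrite /lhs; ring.
lia.
Qed.

Lemma quartic_gtZ (n e : Z) : 0 <= e -> 2 * e ^ 2 + 8 * e + 4 <= n ->
  24 * (e - 1) * (n - 4) < n ^ 2 + 28.
Proof.
move=> e0 hn.
have [s [s0 ->]] : exists s, 0 <= s /\ n = 2 * e ^ 2 + 8 * e + 4 + s.
  by exists (n - (2 * e ^ 2 + 8 * e + 4)); lia.
(* At the smallest admissible [n], a quarter of the difference of the two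
   sides is [e * (e - 4) ^ 2 * (e + 4) + 11]. *)
have h : 0 <= (e - 4) ^ 2 * (e * (e + 4)) by nia.
have h2 : 0 <= s * ((e - 2) ^ 2) by nia.
nia.
Qed.
End Polynomials.

Section Seq.
Local Open Scope ring_scope.

Lemma ratio_step (T A b i q0 q1 : int) :
  0 < T -> 0 <= b -> 0 <= i -> 0 < q1 ->
  T * q0 <= 2 * i ^+ 2 * q1 -> 4 * b * i <= T * A -> 2 * b * q0 <= i * A * q1.
Proof.
move=> T0 b0 i0 q1_gt0 hq hA; rewrite -(ler_pM2l T0).
have -> : T * (2 * b * q0) = 2 * b * (T * q0) by ring.
have -> : T * (i * A * q1) = (T * A) * (i * q1) by ring.
apply: (@le_trans _ _ (4 * b * i * (i * q1))); last first.
  by rewrite ler_wpM2r // mulr_ge0 // ltW.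
have -> : 4 * b * i * (i * q1) = 2 * b * (2 * i ^+ 2 * q1) by ring.
by rewrite ler_wpM2l // mulr_ge0.
Qed.

(** The sums [Q i] over balls of radius [i] satisfy this recurrence, where [th]
    is an eigenvalue.  By induction [Q i] is positive and the ratio of [Q i.+1]
    to [Q i] is at least [T i / (2 * i.+1 ^ 2)] for the linear function [T]
    below.  Its slope is chosen so that the induction step amounts to
    [4 * b * I <= T i * (n - 8 + 4 * I)], which is [cubic_geZ], while [T] is
    still positive up to [e - 1] by [quartic_gtZ]. *)
Lemma lloyd_recurrence_pos (n : int) (w w' e : nat) (th : int) (Q : nat -> int) :
  (w <= w')%N -> n = w%:Z + w'%:Z ->
  (e ^ 2 + 4 * e + 2 <= w)%N ->
  n ^+ 2 + 28 <= 16 * th ->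
  (forall i : nat, (i < e)%N -> i.+1%:Z ^+ 2 * Q i.+1 =
     (th - i%:Z * (n - 2 - 2 * i%:Z)) * Q i
     - (w%:Z - i%:Z) * (w'%:Z - i%:Z) * (if i is j.+1 then Q j else 0)) ->
  0 < Q 0 -> 0 < Q e.
Proof.
move=> ww' hn hw hth rec Q0.
pose T (i : nat) := 2 * th - i%:Z * (3 * n - 12).
have T_ge i : n ^+ 2 + 28 - 24 * i%:Z * (n - 4) <= 8 * T i.
  by rewrite /T; lia.
have hnZ : 2 * e%:Z ^+ 2 + 8 * e%:Z + 4 <= n by lia.
have n4 : 0 <= n - 4 by clear -hnZ; nia.
have T_gt0 i : (i < e)%N -> 0 < T i.
  move=> ie; have T_gei := T_ge i.
  have h1 : 24 * (e%:Z - 1) * (n - 4) < n ^+ 2 + 28.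
    by have := @quartic_gtZ (ssrZ.Z_of_int n) (ssrZ.Z_of_int e); lia.
  have h2 : 24 * i%:Z * (n - 4) <= 24 * (e%:Z - 1) * (n - 4).
    by rewrite ler_wpM2r //; lia.
  by clear -T_gei h1 h2; lia.
have next_gt0 (i : nat) q q1 : 0 < T i -> 0 < q ->
    T i * q <= 2 * i.+1%:Z ^+ 2 * q1 -> 0 < q1.
  move=> Ti q0 h.
  have : 0 < 2 * i.+1%:Z ^+ 2 * q1 by apply: lt_le_trans h; apply: mulr_gt0.
  by rewrite pmulr_rgt0.
have claim i : (i < e)%N ->
    0 < Q i /\ T i * Q i <= 2 * i.+1%:Z ^+ 2 * Q i.+1.
  elim: i => [|i IH] ie.
    have := rec 0%N ie; rewrite /T !mul0r !subr0 mulr0 subr0 expr1n mul1r => ->.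
    by split=> //; lia.
  have [Qi hi] := IH (ltnW ie); have Ti := T_gt0 _ (ltnW ie).
  have Qi1 : 0 < Q i.+1 by apply: next_gt0 hi.
  split=> //; have := rec _ ie => /= E.
  set I := i.+1%:Z in E hi *.
  pose b := (w%:Z - I) * (w'%:Z - I).
  have Iw : I <= w%:Z by rewrite /I; clear -ie hw; nia.
  have i1n : 2 * I ^+ 2 + 12 * I + 14 <= n.
    by rewrite /I; clear -ie hnZ; nia.
  have I1 : 1 <= I by [].
  have b0 : 0 <= b by apply: mulr_ge0; lia.
  have n8 : 0 <= n - 8 + 4 * I by clear -i1n I1; nia.
  have key : 4 * b * I <= T i * (n - 8 + 4 * I).
    have h1 : 4 * b <= (n - 2 * I) ^+ 2.
      rewrite -subr_ge0; have -> : (n - 2 * I) ^+ 2 - 4 * b = (w%:Z - w'%:Z) ^+ 2.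
        by rewrite /b hn; ring.
      exact: sqr_ge0.
    have h2 : 8 * I * (n - 2 * I) ^+ 2
      <= (n - 8 + 4 * I) * (n ^+ 2 + 28 - 24 * (I - 1) * (n - 4)).
      by have := @cubic_geZ (ssrZ.Z_of_int n) (ssrZ.Z_of_int I); clear -i1n I1; lia.
    have h3 := T_ge i; rewrite (_ : i%:Z = I - 1) in h3; last by rewrite /I; lia.
    have h4 := ler_wpM2l n8 h3.
    have h5 : 8 * I * (4 * b) <= 8 * I * (n - 2 * I) ^+ 2.
      by rewrite ler_wpM2l //; lia.
    by clear -h2 h4 h5; lia.
  have h := ratio_step Ti b0 (isT : 0 <= I) Qi1 hi key.
  rewrite -[leRHS]mulrA E -/b /T -/I.
  by clear -h; lia.
case: e => [//|e] in hw rec T_gt0 hnZ claim *.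
have [Qe he] := claim e (ltnSn e).
by apply: next_gt0 he => //; apply: T_gt0.
Qed.
End Seq.

(** * Lower bounds on the strength *)

Section Strength.
Variables (n w e : nat) (C : {set {set 'I_n}}).
Hypothesis perfC : perfect_code w e C.
Hypothesis wn : w <= n.

(** The sums over the balls around the codewords satisfy the recurrence and end
    with zero.  If positivity propagates from [Q 0] to [Q e], then by linearity
    so does negativity, and [Q 0], the sum over the code, is zero. *)
Lemma perfect_design (t0 : nat) :
  (forall t (Q : nat -> int), (0 < t <= t0)%N ->
    (forall i : nat, (i < e)%N -> i.+1%:Z ^+ 2 * Q i.+1 =
     (lloyd_eigenvalue n w t - i%:Z * ((w%:Z + (n - w)%:Z) - 2 - 2 * i%:Z)) * Q i
     - (w%:Z - i%:Z) * ((n - w)%:Z - i%:Z) * (if i is j.+1 then Q j else 0)) ->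
    0 < Q 0 -> 0 < Q e)%R ->
  is_design t0 C.
Proof.
move=> pos; apply: (pair_sums_design (code_card perfC)) => l ul lt.
have l0 : 0 < size l by case/andP: lt.
have rec := code_ball_sum_recurrence perfC wn ul.
have := code_ball_sum_perfect perfC ul l0.
rewrite -(code_ball_sum0 perfC); set Q := code_ball_sum _ _ _ in rec * => Qe.
apply/eqP; case: (ltgtP (Q 0) 0%R) => // Q0.
- have := pos (size l) (fun i => - Q i)%R lt _ _; rewrite Qe oppr0 ltxx.
  apply=> [i _|]; last by rewrite oppr_gt0.
  rewrite mulrN rec; case: i => [|i]; ring.
- by have := pos (size l) Q lt (fun i _ => rec i) Q0; rewrite Qe ltxx.
Qed.

End Strength.

(** The bound on the eigenvalue needed in [lloyd_recurrence_pos] is sharp at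
    [2 * t + 1 = w] and [n = 2 * w]; for [w = 2 * t + 1 + a] and [n - w = w + b]
    the difference is a polynomial in [t], [a], [b] which is nonnegative for
    [b <= w]. *)
Lemma half_design n w e (C : {set {set 'I_n}}) : perfect_code w e C ->
  0 < e -> 2 * w <= n -> n - w <= 2 * w -> e ^ 2 + 4 * e + 2 <= w ->
  is_design (w.-1)./2 C.
Proof.
move=> perfC e0 wn nw ew; apply: (perfect_design perfC) => [|t Q /andP[t0 tw] rec].
  by lia.
have wt : 2 * t <= w.-1 by lia.
apply: lloyd_recurrence_pos ew _ rec => //; first by lia.
have [a aE] : exists a, w = 2 * t + 1 + a by exists (w - (2 * t + 1)); lia.
have [b bE] : exists b, n - w = w + b by exists (n - w - w); lia.
have bw : b <= w by lia.
rewrite /lloyd_eigenvalue bE aE !PoszD -subr_ge0.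
set lhs := (X in (0 <= X)%R).
have -> : (lhs = (2 * b)%:Z * (4 * (t + 1 + a) - 2 * b)%:Z + (3 * b ^ 2 + 4 * b
    + 4 * a * b + 4 * a * (4 * (t + 1) + 3 * a) + 8 * a)%:Z)%R.
  rewrite /lhs -subzn; last by lia.
  rewrite !(PoszD, PoszM); ring.
by [].
Qed.

(** For [e = 1] the recurrence has a single step, and [Q 1] is the multiple of
    [Q 0] by an eigenvalue that is positive in this range. *)
Lemma excess_design n w (C : {set {set 'I_n}}) : perfect_code w 1 C ->
  2 * w <= n -> n <= 3 * w - 3 -> is_design (n - 2 * w - 1) C.
Proof.
move=> perfC wn nw; apply: (perfect_design perfC) => [|t Q /andP[t0 tw] rec Q0].
  by lia.
have := rec 0 isT; rewrite !mul0r !subr0 mulr0 subr0 expr1n mul1r => ->.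
rewrite mulr_gt0 // /lloyd_eigenvalue.
have : (4 * w%:Z <= (w%:Z - t%:Z) * ((n - w)%:Z - t%:Z))%R by nia.
lia.
Qed.

(** * Counting codewords *)

Section BallSize.
Variables (n w : nat).
Hypothesis wn : w <= n.

Lemma PhiS (e : nat) : Phi e.+1 n w = Phi e n w + 'C(w, e.+1) * 'C(n - w, e.+1).
Proof. by rewrite /Phi big_nat_recr. Qed.

Lemma Phi0 : Phi 0 n w = 1.
Proof. by rewrite /Phi big_nat1 !bin0. Qed.

(** Apply [ball_recurrence] to the constant function, which is the empty
    product of pair differences. *)
Lemma card_johnson_ball (e : nat) (X : {set 'I_n}) : #|X| = w ->
  #|johnson_ball w e X| = Phi e n w.
Proof.
move=> Xw; apply/eqP; rewrite -eqz_nat; apply/eqP.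
pose one (Y : {set 'I_n}) : int := pair_fun [::] Y.
have oneE Y : one Y = 1%R by rewrite /one /pair_fun big_nil.
have sumE i : (#|johnson_ball w i X|%:Z = ball_sum w one X i)%R.
  by rewrite /ball_sum (eq_bigr (fun=> 1%R)) // sumr_const natz.
have eigen (Y : {set 'I_n}) : #|Y| = w ->
    (\sum_(p in Y) \sum_(q in ~: Y) one (exchange Y p q)
      = w%:Z * (n - w)%:Z * one Y)%R.
  move=> Yw; rewrite pair_fun_eigen // [#|~: Y|]cardsCs setCK card_ord Yw /=.
  by rewrite !subr0.
have rec := ball_recurrence wn eigen Xw.
have binS (m i : nat) : ((i.+1)%:Z * 'C(m, i.+1)%:Z = (m%:Z - i%:Z) * 'C(m, i)%:Z)%R.
  have [mi|im] := ltnP m i; first by rewrite !bin_small ?mulr0 // ltnW.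
  by rewrite subzn // -!PoszM mul_bin_left.
rewrite sumE; suff [] : (ball_sum w one X e = (Phi e n w)%:Z /\
  ball_sum w one X e.+1 = (Phi e.+1 n w)%:Z)%R by [].
have next (i : nat) (prev : int) :
    ball_sum w one X i = (prev + ('C(w, i) * 'C(n - w, i))%:Z)%R ->
    prev = (if i is j.+1 then ball_sum w one X j else 0%R) ->
    ball_sum w one X i.+1 =
      (ball_sum w one X i + ('C(w, i.+1) * 'C(n - w, i.+1))%:Z)%R.
  move=> Ei Ep; have i0 : (i.+1%:Z ^+ 2 != 0 :> int)%R by [].
  apply: (mulfI i0); rewrite rec -Ep.
  rewrite [in RHS]mulrDr PoszM.
  have -> : (i.+1%:Z ^+ 2 * ('C(w, i.+1)%:Z * 'C(n - w, i.+1)%:Z) =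
    (i.+1%:Z * 'C(w, i.+1)%:Z) * (i.+1%:Z * 'C(n - w, i.+1)%:Z))%R by ring.
  by rewrite !binS Ei PoszM; ring.
have base : ball_sum w one X 0 = 1%R.
  by rewrite -sumE johnson_ball0 // cards1.
elim: e => [|i [IH0 IH1]].
  split; first by rewrite base Phi0.
  by rewrite (next 0 0%R) ?base ?add0r ?bin0 // PhiS Phi0 PoszD.
split=> //; have -> := next i.+1 _ _ erefl; first by rewrite IH1 -PoszD -PhiS.
by rewrite IH1 IH0 PhiS PoszD.
Qed.

Lemma card_perfect_code (e : nat) (C : {set {set 'I_n}}) : perfect_code w e C ->
  #|C| * Phi e n w = 'C(n, w).
Proof.
move=> perfC; case: (perfC) => _ inj part.
rewrite -sum_nat_const (eq_bigr (fun X => #|johnson_ball w e X|)); last first.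
  by move=> X XC; rewrite card_johnson_ball // (code_card perfC).
rewrite -(big_imset (fun A : {set {set 'I_n}} => #|A|)) //= -(card_partition part).
have := card_draws 'I_n w; rewrite card_ord => <-.
by apply: eq_card => X; rewrite !inE.
Qed.

End BallSize.

Lemma disjoint_setU1 (T : finType) (z : T) (A B : {set T}) :
  [disjoint z |: A & B] = (z \notin B) && [disjoint A & B].
Proof. by rewrite -setI_eq0 setIUl setU_eq0 !setI_eq0 disjoints1. Qed.

Section DesignCounts.
Variables (n w : nat) (C : {set {set 'I_n}}).
Hypothesis Cw : forall X, X \in C -> #|X| = w.
Implicit Types I K X : {set 'I_n}.

Lemma sum_card_containing I :
  \sum_(z in ~: I) #|[set X in C | z |: I \subset X]| =
  (w - #|I|) * #|[set X in C | I \subset X]|.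
Proof.
rewrite mulnC -sum_nat_const.
rewrite (eq_bigr (fun z => \sum_(X in [set X in C | I \subset X]) (z \in X))).
  rewrite exchange_big; apply: eq_bigr => X; rewrite inE => /andP[XC IX].
  rewrite -big_mkcondr sum1_card -(Cw XC) -[in RHS](setIidPr IX) -cardsD.
  by apply: eq_card => z; rewrite [LHS]unfold_in /= !inE.
move=> z _; rewrite -big_mkcondr -sum1_card; apply: eq_bigl => X.
by rewrite !inE subUset sub1set andbA andbAC -andbA.
Qed.

Lemma design_down j : j < w -> is_design j.+1 C -> is_design j C.
Proof.
move=> jw [lam Hlam].
pose c I := #|[set X in C | I \subset X]|.
have Hc I : #|I| = j -> (w - j) * c I = (n - j) * lam.
  move=> Ij; rewrite -[in LHS]Ij -sum_card_containing.
  rewrite (eq_bigr (fun=> lam)) ?sum_nat_const.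
    by rewrite [#|~: I|]cardsCs setCK card_ord Ij.
  by move=> z; rewrite inE => zI; rewrite Hlam // cardsU1 zI Ij.
have [I /eqP Ij|noI] := pickP [pred I : {set 'I_n} | #|I| == j].
  exists (c I) => I' I'j; apply/eqP; rewrite -/(c I').
  by rewrite -(eqn_pmul2l (_ : 0 < w - j)) ?Hc // subn_gt0.
by exists 0 => I /eqP Ij; have := noI I; rewrite /= Ij.
Qed.

Lemma design_le i j : i <= j -> j <= w -> is_design j C -> is_design i C.
Proof.
elim: j => [|j IH]; first by rewrite leqn0 => /eqP->.
rewrite leq_eqVlt => /orP[/eqP->//|ij jw Cj].
by apply: IH => //; [exact: ltnW | exact: design_down].
Qed.

Variables (phi m : nat).
Hypotheses (wn : w <= n) (phiw : phi <= w) (Cphi : is_design phi C).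
Hypothesis cardC : #|C| * m = 'C(n, w).

(** Going up from [#|C| * m = 'C(n, w)]: the count of the codewords containing
    [I] is constant for each size of [I], so adding a point multiplies it by
    [(w - #|I|) / (n - #|I|)]. *)
Lemma design_count I : #|I| <= phi ->
  #|[set X in C | I \subset X]| * m = 'C(n - #|I|, w - #|I|).
Proof.
elim: {I}#|I| {-2}I (erefl #|I|) => [|i IH] I Ii iphi.
  rewrite Ii !subn0 -cardC (cards0_eq Ii); congr (_ * _).
  by apply: eq_card => X; rewrite !inE sub0set andbT.
have [z zI] : exists z, z \in I by apply/set0Pn; rewrite -card_gt0 Ii.
set I' := I :\ z.
have I'i : #|I'| = i by have := cardsD1 z I; rewrite zI Ii => -[].
rewrite Ii in iphi *; have [lam Hlam] := design_le iphi phiw Cphi.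
have E : (n - i) * lam = (w - i) * #|[set X in C | I' \subset X]|.
  rewrite -I'i -sum_card_containing (eq_bigr (fun=> lam)) ?sum_nat_const.
    by rewrite [#|~: I'|]cardsCs setCK card_ord.
  by move=> z'; rewrite inE => zI'; rewrite Hlam // cardsU1 zI' I'i.
rewrite Hlam //; apply/eqP; rewrite -(eqn_pmul2l (_ : 0 < n - i)); last by lia.
rewrite mulnA E -mulnA IH // ?I'i; last exact: ltnW.
have -> : n - i = (n - i.+1).+1 by lia.
have -> : w - i = (w - i.+1).+1 by lia.
by rewrite -mul_bin_diag.
Qed.

(** Splitting the codewords by the membership of one point of [K] reduces
    this to smaller [K]; the binomials follow Pascal's rule. *)
Lemma design_count2 I K : [disjoint I & K] -> #|I| + #|K| <= phi ->
  #|[set X in C | (I \subset X) && [disjoint X & K]]| * m =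
    'C(n - #|I| - #|K|, w - #|I|).
Proof.
elim: {K}#|K| {-2}K (erefl #|K|) I => [|k IH] K Kk I IK ikphi.
  rewrite Kk subn0 -design_count; last by lia.
  congr (_ * _); apply: eq_card => X; rewrite !inE (cards0_eq Kk).
  by rewrite -setI_eq0 setI0 eqxx andbT.
have [z zK] : exists z, z \in K by apply/set0Pn; rewrite -card_gt0 Kk.
set K' := K :\ z.
have K'k : #|K'| = k by have := cardsD1 z K; rewrite zK Kk => -[].
have zI : z \notin I by rewrite (disjointFl IK).
have IK' : [disjoint I & K'] by apply: disjointWr IK; exact: subsetDl.
have zIK' : [disjoint z |: I & K'].
  by rewrite disjoint_setU1 IK' !inE eqxx.
have zIc : #|z |: I| = #|I|.+1 by rewrite cardsU1 zI.
have H1 := IH K' K'k I IK'; have := IH K' K'k (z |: I) zIK'.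
rewrite zIc K'k in H1 * => H2.
have split_z : #|[set X in C | (I \subset X) && [disjoint X & K']]| =
    #|[set X in C | (z |: I \subset X) && [disjoint X & K']]| +
    #|[set X in C | (I \subset X) && [disjoint X & K]]|.
  have KE X : [disjoint X & K] = (z \notin X) && [disjoint X & K'].
    by rewrite -(setD1K zK) -/K' !(disjoint_sym (mem X)) disjoint_setU1.
  rewrite -(cardsID [set X : {set 'I_n} | z \in X]); congr (_ + _).
    apply: eq_card => X; rewrite !inE subUset sub1set.
    by case: (z \in X); rewrite ?andbF ?andbT.
  apply: eq_card => X; rewrite !inE KE.
  by case: (z \in X); rewrite ?andbF ?andbT.
rewrite Kk in ikphi *; move: H1; rewrite split_z mulnDl => H1.
have {}H1 := H1 (ltac:(lia)); have {}H2 := H2 (ltac:(lia)).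
apply/eqP; rewrite -(eqn_add2l 'C(n - #|I|.+1 - k, w - #|I|.+1)).
rewrite -{1}H2 H1.
have -> : n - #|I| - k = (n - #|I|.+1 - k).+1 by lia.
have -> : w - #|I| = (w - #|I|.+1).+1 by lia.
have -> : n - #|I| - k.+1 = n - #|I|.+1 - k by lia.
by rewrite binS addnC.
Qed.

(** Prescribe the intersection of the codewords with a [phi]-set [I :|: K] to
    be [I], of size [w - k]. *)
Lemma design_dvd_bin k : w - phi <= k <= w -> m %| 'C(n - phi, k).
Proof.
move=> /andP[phik kw].
have [I _ Ik] : exists2 I : {set 'I_n}, I \subset setT & #|I| = w - k.
  by apply: exists_subset_card; rewrite cardsT card_ord; lia.
have [K KI Kk] : exists2 K : {set 'I_n}, K \subset ~: I & #|K| = phi - (w - k).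
  by apply: exists_subset_card; rewrite cardsCs setCK card_ord Ik; lia.
have IK : [disjoint I & K] by rewrite disjoint_sym disjoints_subset.
have := design_count2 IK; rewrite Ik Kk => H.
have {}H := H (ltac:(lia)).
have -> : 'C(n - phi, k) = 'C(n - (w - k) - (phi - (w - k)), w - (w - k)).
  by congr ('C(_, _)); lia.
by rewrite -H dvdn_mull.
Qed.
End DesignCounts.

(** * Prime powers and binomial coefficients *)

Lemma logn_fact_ext p m M : prime p -> m <= M ->
  logn p m`! = \sum_(1 <= i < M.+1) m %/ p ^ i.
Proof.
move=> p_pr mM; rewrite logn_fact // [RHS](big_cat_nat_idem _ (n := m.+1)) //=.
rewrite [X in _ = _ + X]big_nat_cond [X in _ = _ + X]big1 ?addn0 // => i.
rewrite andbT => /andP[mi _]; apply: divn_small.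
exact: ltn_trans mi (ltn_expl i (prime_gt1 p_pr)).
Qed.

Lemma sum_bool_interval j s M : \sum_(1 <= i < M.+1) (j < i <= s) = minn s M - j.
Proof.
elim: M => [|M IH]; first by rewrite big_geq // minn0.
by rewrite big_nat_recr //= IH; case: ltnP; case: leqP => /=; lia.
Qed.

(** Legendre's formula: the [i]-th digit position contributes at most one, and
    nothing if [p ^ i] divides [k] or exceeds [N]. *)
Lemma logn_bin_le p N k j : prime p -> k <= N -> p ^ j %| k ->
  logn p 'C(N, k) <= trunc_log p N - j.
Proof.
move=> p_pr kN jk; have p1 := prime_gt1 p_pr.
case: (posnP N) => [N0|N0].
  by move: kN; rewrite N0 leqn0 => /eqP->; rewrite bin0 logn1.
set s := trunc_log p N.
have sN : p ^ s <= N by apply: trunc_logP.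
have Ns : N < p ^ s.+1 by apply: trunc_log_ltn.
have main : logn p N`! <= (s - j) + (logn p k`! + logn p (N - k)`!).
  rewrite !(@logn_fact_ext p _ N) ?leq_subr // -big_split /=.
  apply: (@leq_trans (\sum_(1 <= i < N.+1)
    ((j < i <= s) + (k %/ p ^ i + (N - k) %/ p ^ i)))).
    rewrite !(big_nat _ _ 1 N.+1); apply: leq_sum => i /andP[i1 iN].
    case: (leqP i s) => [is_|si]; last first.
      by rewrite divn_small // (leq_trans Ns) // leq_exp2l.
    case: (leqP i j) => [ij|ji] /=.
      have dk : p ^ i %| k by apply: dvdn_trans jk; apply: dvdn_exp2l.
      by rewrite -[in leqLHS](subnKC kN) divnDl.
    rewrite -[in leqLHS](subnKC kN) divnD ?expn_gt0 ?prime_gt0 //.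
    by rewrite addnC leq_add2r leq_b1.
  by rewrite big_split leq_add2r /= sum_bool_interval; lia.
have := bin_fact kN => /(congr1 (logn p)).
rewrite !lognM ?muln_gt0 ?fact_gt0 ?bin_gt0 //; lia.
Qed.

(** A number [q < d] has a multiple among the [w - d + 1 >= d - 1] consecutive
    integers from [d] to [w]; a larger [q] is in one of the two ranges itself,
    since [N - w <= w + 1]. *)
Lemma multiple_in_range N d w q : 0 < q <= N - d -> d <= w -> w <= N - d ->
    2 * d <= w + 2 -> N <= 2 * w + 1 ->
  exists2 k, q %| k & (d <= k <= w) || (N - w <= k <= N - d).
Proof.
move=> /andP[q0 qN] dw wN dw2 Nw.
case: (leqP d q) => [dq|qd]; first by exists q => //; lia.
exists (w %/ q * q); first exact: dvdn_mull.
have := divn_eq w q; have := ltn_pmod w q0; lia.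
Qed.

(** By [logn_bin_le] with [q = p ^ s] or [q = p ^ s.-1], where [p ^ s] is the
    largest power of [p] up to [a + d]. *)
Lemma dvdn_prod_primes_power_in (a d m : nat) :
  0 < a -> 0 < m -> d <= a ->
  (forall q, 0 < q <= a ->
     exists k, [/\ k <= a + d, q %| k & m %| 'C(a + d, k)]) ->
  m %| prod_primes_power_in a (a + d) /\ squarefree m.
Proof.
move=> a0 m0 da Hm; set N := a + d.
have log_le p : prime p -> logn p m <= has_power_in a N p.
  move=> p_pr; have p1 := prime_gt1 p_pr.
  have logm q j : q = p ^ j -> q <= a -> logn p m <= trunc_log p N - j.
    move=> qE qa; have q0 : 0 < q by rewrite qE expn_gt0 prime_gt0.
    case: (Hm q); first by rewrite q0.
    move=> k [kN qk mk].
    apply: leq_trans (logn_bin_le p_pr kN _); last by rewrite -qE.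
    by apply: dvdn_leq_log => //; rewrite bin_gt0.
  set s := trunc_log p N in logm *.
  have sN : p ^ s <= N by apply: trunc_logP => //; rewrite /N; lia.
  case: (leqP (p ^ s) a) => [sa|sa].
    by have := logm _ _ erefl sa; rewrite subnn; lia.
  have s1 : 0 < s by case: (s) sa => //; rewrite expn0; lia.
  rewrite (introT (has_power_inP a N p_pr)); last by exists s => //; lia.
  apply: leq_trans (logm _ s.-1 erefl _) _; last by lia.
  by move: sN sa; rewrite -{1 2}(prednK s1) expnS /N; nia.
split.
  apply/(dvdn_partP _ m0) => p; rewrite mem_primes => /and3P[p_pr _ pm].
  have lp : 0 < logn p m by rewrite logn_gt0 mem_primes p_pr m0.
  have := log_le p p_pr; case hp : has_power_in => lp1; last by lia.
  have -> : m`_p = p.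
    by rewrite p_part (_ : logn p m = 1) ?expn1 //; move: lp lp1 => /=; lia.
  have [s s1 sN] := has_power_inP a N p_pr hp.
  have pN : p < N.+1.
    case/andP: sN => _; apply: leq_trans.
    by rewrite -{1}(expn1 p) leq_exp2l // prime_gt1.
  rewrite /prod_primes_power_in (big_rem p) ?mem_index_iota //= p_pr hp.
  exact: dvdn_mulr.
move=> k km; apply/eqP; apply: contraT => k1.
have k0 : 0 < k by case: k km k1 => //; rewrite exp0n // dvd0n; lia.
have p_pr : prime (pdiv k) by apply: pdiv_prime; lia.
have : 2 <= logn (pdiv k) m.
  by rewrite -pfactor_dvdn // (dvdn_trans _ km) // dvdn_exp2r // pdiv_dvd.
by have := log_le _ p_pr; lia.
Qed.

Theorem corollary5p3 (n w e phi d : nat) (C : {set {set 'I_n}})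
  (hw : 2 <= 2 * w) (hn : 2 * w <= n) (he : 1 <= e)
  (hC : nontrivial_perfect_code w e C)
  (hphi : has_strength w C phi)
  (hd : d = w - phi) :
  Phi e n w %| prod_primes_power_in (n - w) (n - w + d) /\
  squarefree (Phi e n w).
Proof.
case: hC => perfC ntriv; case: hphi => phiw Cphi max_phi.
have wn : w <= n by lia.
have ew := nontrivial_width perfC ntriv hn.
have cardC := card_perfect_code wn perfC.
have C0 : C != set0.
  apply/eqP => C0; have : 0 < 'C(n, w) by rewrite bin_gt0.
  by rewrite -cardC C0 cards0.
have roos : e * (n - w - e) <= e.+1 * (w - e.+1).
  by apply: (roos_bound perfC _ _ C0); lia.
have fisher : e ^ 2 + 4 * e + 2 <= w.
  by apply: (fisher_bound perfC _ _ _ C0); lia.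
have nw3 : n <= 3 * w - 3 by clear -roos he ew hn; nia.
have phi_half : (w.-1)./2 <= phi.
  by apply: max_phi; [lia | apply: (half_design perfC) => //; lia].
have phi_excess : n - 2 * w <= phi + 1.
  have [e1|e1] := eqVneq e 1; last first.
    by clear -roos he ew hn e1 phi_half; nia.
  rewrite e1 in perfC; suff : n - 2 * w - 1 <= phi by lia.
  by apply: max_phi; [lia | apply: excess_design].
have dvd := design_dvd_bin (code_card perfC) wn phiw Cphi cardC.
have NE : n - w + d = n - phi by lia.
have Phi_gt0 : 0 < Phi e n w.
  by move: (bin_gt0 n w); rewrite -cardC muln_gt0 wn => /andP[].
apply: dvdn_prod_primes_power_in => //; [by lia | by lia |].
move=> q qn; have Na : n - w + d - d = n - w by rewrite addnK.
have [|||||k qk kr] := @multiple_in_range (n - w + d) d w q;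
  rewrite ?Na //; try lia.
exists k; split=> //; first by lia.
case/orP: kr => kr; first by rewrite NE; apply: dvd; lia.
rewrite -bin_sub ?NE; last by lia.
by apply: dvd; lia.
Qed.
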